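(* For each $s \in \mathbb{N}$ there exists a constant $C_1 = C_1(s)>0$ such that the following holds. Let $\Delta>0$, $\rho\ge 0$, $2\le \ell\le s$ and $\ell-1\le \tau\le \pi/\Delta$ satisfy $4\tau\Delta \le \min\left(\rho, \frac{1}{s^2}\right)$. Let $\boldsymbol{\xi}=(\xi_1,\dots,\xi_s)\subset \frac{1}{s^2}\left(-\frac{\pi}{2},\frac{\pi}{2}\right]$ form a $(\Delta,\rho,s,\ell,\tau)$-clustered configuration, and let $N\in\mathbb{N}$ satisfy \[ \max\left(\frac{4\pi s}{\rho},\,4s^3\right) \le N \le \frac{\pi s}{\tau\Delta}. \] Then \[ \sigma_{\min}\big(U_N(\boldsymbol{\xi})\big) \ge C_1\,(N\Delta)^{2\ell-1}. \]
   Context: For $N\in\mathbb{N}$ and pairwise distinct real nodes $\boldsymbol{\xi}=(\xi_1,\dots,\xi_s)$, $\xi_j\in(-\pi,\pi]$, put $z_j=e^{i\xi_j}$ and define the $(2N+1)\times 2s$ confluent Vandermonde matrix \[U_N(\boldsymbol{\xi}) = \frac{1}{\sqrt{2N}}\big[\, z_j^k \quad k z_j^{k-1}\,\big]^{j=1,\dots,s}_{k=0,\dots,2N},\] i.e. row $k$ ($k=0,\dots,2N$) has entries $z_1^k,\dots,z_s^k, kz_1^{k-1},\dots,kz_s^{k-1}$ (scaled by $1/\sqrt{2N}$). $\sigma_{\min}$ denotes the smallest singular value. Wraparound distance: $\|t\|_{\tilde{\mathbb{T}}}=|\mathrm{Arg}\,e^{it}|$, where $\mathrm{Arg}$ is the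 principal argument in $(-\pi,\pi]$. Clustered configuration: for $\Delta>0$, $2\le\ell\le s$, $\ell-1\le\tau\le\pi/\Delta$, $\rho\ge0$, a node vector $\boldsymbol{x}=(x_1,\dots,x_s)\subset(-\frac{\pi}{2},\frac{\pi}{2}]$ of distinct nodes forms a $(\Delta,\rho,s,\ell,\tau)$-clustered configuration if for each $x_j$ there is a subset $\boldsymbol{x}^{(j)}=\{x_{j,1},\dots,x_{j,r_j}\}\subset\boldsymbol{x}$ of $1\le r_j\le\ell$ distinct nodes with $x_{j,1}=x_j$ such that (1) $\Delta\le\|y-x_j\|_{\tilde{\mathbb{T}}}\le\tau\Delta$ for all $y\in\boldsymbol{x}^{(j)}\setminus\{x_j\}$, and (2) $\|y-x_j\|_{\tilde{\mathbb{T}}}\ge\rho$ for all $y\in\boldsymbol{x}\setminus\boldsymbol{x}^{(j)}$. *)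

(* Defs.v *)
From HB Require Import structures.
From mathcomp Require Import all_boot all_order all_algebra.
From mathcomp Require Import all_classical all_reals.
From mathcomp Require Import topology normedtype sequences trigo.
From mathcomp Require Import complex.
Set Implicit Arguments. Unset Strict Implicit. Unset Printing Implicit Defensive.
Import Order.TTheory GRing.Theory Num.Theory ComplexField.
Local Open Scope ring_scope.
Local Open Scope classical_set_scope.

Section Defs.
Variable R : realType.

(* Principal argument of e^{it}: the unique t - 2 pi k lying in (-pi, pi]. *)
Definition Arg_exp (t : R) : R :=
  t - 2 * pi * (Num.ceil ((t - pi) / (2 * pi)))%:~R.

Definition wdist (t : R) : R := `|Arg_exp t|.

Definition expi (t : R) : R[i] := (cos t +i* sin t)%C.

Definition vnorm n (v : 'cV[R[i]]_n) : R :=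
  Num.sqrt (\sum_(i < n) ComplexField.Normc.normc (v i 0) ^+ 2).

(* smallest singular value of an m x n matrix (m >= n):
   sigma_min(A) = inf_{||v|| = 1} ||A v|| *)
Definition sigma_min m n (A : 'M[R[i]]_(m, n)) : R :=
  inf [set vnorm (A *m v) | v in [set v : 'cV[R[i]]_n | vnorm v = 1]].

Definition U_N (N s : nat) (xi : 'I_s -> R) : 'M[R[i]]_((2 * N).+1, s + s) :=
  \matrix_(k < (2 * N).+1, j < s + s)
    (((Num.sqrt (2 * N)%:R)^-1)%:C%C *
     match fintype.split j with
     | inl j1 => expi (xi j1) ^+ k
     | inr j2 => k%:R * expi (xi j2) ^+ k.-1
     end).

Definition clustered (Delta rho : R) (s ell : nat) (tau : R) (x : 'I_s -> R) : Prop :=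
  [/\ 0 < Delta, (2 <= ell <= s)%N, (ell.-1)%:R <= tau <= pi / Delta & 0 <= rho] /\
  [/\ (forall j, - (pi / 2) < x j <= pi / 2),
      injective x &
      forall j : 'I_s, exists S : {set 'I_s},
        [/\ j \in S, (1 <= #|S| <= ell)%N,
            (forall k, k \in S -> k != j ->
               Delta <= wdist (x k - x j) <= tau * Delta) &
            (forall k, k \notin S -> rho <= wdist (x k - x j))]].

End Defs.
Arguments clustered {R} Delta rho s ell tau x.

(* Main.v *)
Require Import Defs.
From HB Require Import structures.
From mathcomp Require Import all_boot all_order all_algebra.
From mathcomp Require Import all_classical all_reals.
From mathcomp Require Import topology normedtype sequences trigo.
From mathcomp Require Import complex.
From mathcomp Require Import derive realfun ring lra zify.
Import Order.TTheory GRing.Theory Num.Theory ComplexField.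
Import numFieldNormedType.Exports.
Local Open Scope ring_scope.

(* For v = (a, b), sqrt(2N) U_N v is the sequence u_n = L(X^n), n <= 2N, where
   L(p) = sum_m a_m p(z_m) + b_m p'(z_m).  Fix a node z_j and K ~ N / (4s).  Every
   other node z_m is killed by f_m = (X^k - z_m^k) / (z_j^k - z_m^k) for some
   k <= K: for nodes of the cluster of z_j one takes k = K, and the denominator
   is at least K Delta / 2; for the others k is chosen to turn z_m / z_j by about
   a right angle, and the denominator is at least 1.  With G = prod_m f_m^2, the
   values L(X^n G (X^K - z_j^K)) and L(X^n G), n <= N, isolate b_j and then a_j.
   Each factor f_m costs 2 / |z_j^k - z_m^k| in the l^1 norm of the shifted data,
   so |a_j| and |b_j| are O((N Delta)^-(2 ell - 1)) times N^-1 sum_n |u_n|; the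
   last power of N Delta comes from G'(z_j). *)

Local Notation normc := ComplexField.Normc.normc.

(** * Isolating one node by products of binomials X^k - e *)

Section HermiteFunctional.
Variables (C : numFieldType) (s N : nat) (z a b : 'I_s -> C).

Definition hermite (p : {poly C}) : C :=
  \sum_m (a m * p.[z m] + b m * p^`().[z m]).

Lemma hermiteB p q : hermite (p - q) = hermite p - hermite q.
Proof.
rewrite /hermite -sumrB; apply: eq_bigr => m _.
by rewrite derivB !hornerD !hornerN; ring.
Qed.

Lemma hermiteZ c p : hermite (c *: p) = c * hermite p.
Proof.
rewrite /hermite mulr_sumr; apply: eq_bigr => m _.
by rewrite derivZ !hornerZ; ring.
Qed.

(* Averaging over N + 1 shifts replaces sup_n |u_n| by N^-1 sum_n |u_n|, which is
   what matches the normalisation 1 / sqrt(2N) of U_N. *)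
Definition window (t : nat) (p : {poly C}) : C :=
  \sum_(n < N.+1) `|hermite ('X^(t + n) * p)|.

(* [D] is the degree budget already spent: t + D <= N keeps all the exponents
   t + n + deg p inside [0, 2N]. *)
Definition window_bounded (p : {poly C}) (D : nat) (B : C) : Prop :=
  forall t, (t + D <= N)%N -> window t p <= B.

(** For t <= N the exponents t, ..., t + N lie in [0, 2N], so each window is a partial sum of the
    full l^1 norm. *)
Lemma window_bounded1 :
  window_bounded 1 0 (\sum_(n < (2 * N).+1) `|hermite 'X^n|).
Proof.
move=> t; rewrite addn0 => tN; rewrite /window.
under eq_bigr do rewrite mulr1.
rewrite -(big_mkord xpredT (fun n => `|hermite 'X^(t + n)|)).
rewrite -(big_mkord xpredT (fun n => `|hermite 'X^n|)).
rewrite (@big_cat_nat _ _ _ t 0%N (2 * N).+1) /=; [|by []|by lia].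
rewrite (@big_cat_nat _ _ _ (t + N.+1) t (2 * N).+1) /=; [|by lia|by lia].
rewrite -[X in _ <= _ + (\big[_/_]_(X <= _ < _) _ + _)](add0n t) big_addn addKn.
under [X in _ <= _ + (X + _)]eq_bigr do rewrite addnC.
by rewrite addrCA lerDl addr_ge0 // sumr_ge0.
Qed.

(** Multiplication by X^k - e subtracts e times a window from its shift by k. Both windows obey the
    old bound, whence the factor 2. *)
Lemma window_boundedM p D B c e k K : (k <= K)%N -> `|e| <= 1 ->
  window_bounded p D B ->
  window_bounded (p * (c *: ('X^k - e%:P))) (D + K) (B * (2 * `|c|)).
Proof.
move=> kK e1 pB t tN.
have -> : B * (2 * `|c|) = `|c| * (B + B) by ring.
have hB1 : window (t + k) p <= B by apply: pB; lia.
have hB2 : window t p <= B by apply: pB; lia.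
apply: le_trans (ler_wpM2l (normr_ge0 c) (lerD hB1 hB2)).
rewrite /window -big_split /= mulr_sumr; apply: ler_sum => n _.
have -> : 'X^(t + n) * (p * (c *: ('X^k - e%:P))) =
    c *: ('X^(t + k + n) * p - e *: ('X^(t + n) * p)).
  by rewrite -!mul_polyC !exprD; ring.
rewrite hermiteZ hermiteB hermiteZ normrM ler_wpM2l //.
apply: le_trans (ler_normB _ _) _.
by rewrite lerD2l normrM ler_piMl.
Qed.

Variables (j : 'I_s) (k : 'I_s -> nat) (K : nat).
Hypothesis z1 : forall m, `|z m| = 1.
Hypothesis kK : forall m, (k m <= K)%N.
Hypothesis zjk : forall m, m != j -> z j ^+ k m != z m ^+ k m.

Let c m := (z j ^+ k m - z m ^+ k m)^-1.
Let f m := c m *: ('X^(k m) - (z m ^+ k m)%:P).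
Let H (r : seq 'I_s) := \prod_(m <- r) f m.

Lemma window_bounded_prod p D B r : window_bounded p D B ->
  window_bounded (p * H r) (D + size r * K) (B * \prod_(m <- r) (2 * `|c m|)).
Proof.
elim: r p D B => [|m r IH] p D B pB.
  by rewrite /H !big_nil !mulr1 mul0n addn0.
rewrite /H !big_cons !mulrA -[B * 2 * _]mulrA /= mulSn addnA.
apply: IH; apply: window_boundedM => //.
by rewrite normrX z1 expr1n.
Qed.

Lemma prod_factor_val r : all (predC1 j) r -> (H r).[z j] = 1.
Proof.
move=> /allP rj; rewrite /H horner_prod big1_seq // => m /andP[_ mr].
by rewrite /f !hornerE mulVf // subr_eq0 zjk //; exact: rj.
Qed.

(** Every factor is 1 at [z j], so the product rule collapses to the sum of the f_m'(z_j), of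
    modulus k_m |c_m|. *)
Lemma prod_factor_deriv r : all (predC1 j) r ->
  `|(H r)^`().[z j]| <= \sum_(m <- r) K%:R * `|c m|.
Proof.
elim: r => [_|m r IH /= /andP[mj rj]].
  by rewrite /H !big_nil derivC horner0 normr0.
have vm : (f m).[z j] = 1.
  by rewrite /f !hornerE mulVf // subr_eq0 zjk.
rewrite /H !big_cons derivM hornerD !hornerM vm -!/(H r) prod_factor_val //.
rewrite mulr1 mul1r; apply: le_trans (ler_normD _ _) _.
apply: lerD (IH rj).
rewrite /f derivZ derivB derivXn derivC subr0 !hornerE hornerMn hornerXn.
rewrite normrM normrMn normrX z1 expr1n mulrC ler_wpM2r //.
by rewrite ler_nat.
Qed.

Lemma prod_factor_root r m : m \in r -> (H r).[z m] = 0.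
Proof.
move=> mr; rewrite /H horner_prod (big_rem m) //= /f !hornerE subrr.
by rewrite mulr0 mul0r.
Qed.

(** The square p * p vanishes to second order at every other node, which kills both the value and
    the derivative terms there. *)
Lemma hermite_double_root p : (forall m, m != j -> p.[z m] = 0) ->
  forall q, hermite (q * (p * p)) =
    a j * (q.[z j] * p.[z j] ^+ 2) +
    b j * (q^`().[z j] * p.[z j] ^+ 2 + q.[z j] * (2 * p.[z j] * p^`().[z j])).
Proof.
move=> p0 q; rewrite /hermite (bigD1 j) //= big1 ?addr0 => [|m mj].
  by rewrite !derivM !(hornerD, hornerM); ring.
by rewrite !derivM !(hornerD, hornerM) (p0 m mj); ring.
Qed.

Let B := \prod_(m | m != j) (2 * `|c m|).
Let T := \sum_(m | m != j) K%:R * `|c m|.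
Let S := \sum_(n < (2 * N).+1) `|hermite 'X^n|.
Hypothesis KN : (s.*2.-1 * K <= N)%N.

Let r := [seq m <- index_enum 'I_s | m != j].

Let rj : all (predC1 j) r. Proof. exact: filter_all. Qed.

Let size_r : size r = s.-1.
Proof.
rewrite size_filter -sum1_count -[in RHS](card_ord s) (cardD1 j) inE /=.
by rewrite sum1_card; apply: eq_card => m; rewrite !inE andbT.
Qed.

Let Hr0 m : m != j -> (H r).[z m] = 0.
Proof.
by move=> mj; apply: prod_factor_root; rewrite mem_filter mj mem_index_enum.
Qed.

Let BrE : \prod_(m <- r) (2 * `|c m|) = B.
Proof. by rewrite /r big_filter. Qed.

Let window_HH : window_bounded (H r * H r) (s.-1.*2 * K) (S * B ^+ 2).
Proof.
have := window_bounded_prod _ _ _ r (window_bounded_prod _ _ _ r window_bounded1).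
by rewrite mul1r size_r BrE -mulrA -expr2 add0n -mulnDl addnn.
Qed.

(** The extra factor X^K - z_j^K vanishes at [z j], so [a j] drops out and [b j] is multiplied by a
    number of modulus K. All N + 1 terms of the window at t = 0 then have the same modulus. *)
Lemma derivative_coeff_bound :
  K%:R * N.+1%:R * `|b j| <= 2 * B ^+ 2 * S.
Proof.
have zK : `|z j ^+ K| <= 1 by rewrite normrX z1 expr1n.
have := window_boundedM _ _ _ 1 _ _ _ (leqnn K) zK window_HH.
(* The 2(s - 1) factors of G and the extra one spend (2s - 1)K. With truncated predecessors this
   needs s > 0, which the index [j] provides. *)
have KN' : (0 + (s.-1.*2 * K + K) <= N)%N.
  by apply: leq_trans KN; case: (s) j => [[]|s' _] //=; lia.
move=> /(_ 0%N KN'); rewrite normr1 mulr1 scale1r.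
have -> : S * B ^+ 2 * 2 = 2 * B ^+ 2 * S by ring.
apply: le_trans; rewrite /window.
have e n : `|hermite ('X^(0 + n) * (H r * H r * ('X^K - (z j ^+ K)%:P)))| =
   K%:R * `|b j|.
  rewrite [_ * ('X^K - _)]mulrC mulrA hermite_double_root //.
  rewrite prod_factor_val // expr1n !mulr1 derivM derivB !derivXn derivC.
  rewrite !(hornerE, hornerMn, hornerXn) subrr.
  rewrite !(mulr0, mul0r, addr0, add0r, subr0) -[z j ^+ K.-1 *+ K]mulr_natr.
  rewrite /= !(mulr0, mul0r, addr0, add0r).
  by rewrite !normrM !normrX z1 !expr1n normr_nat !mul1r mulrC.
rewrite (eq_bigr (fun=> K%:R * `|b j|)) => [|n _]; last exact: e.
by rewrite sumr_const card_ord -[leRHS]mulr_natr mulrAC.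
Qed.

(** Without the extra factor, term n is z_j^n a_j plus b_j times the derivative of X^n G at [z j],
    whose modulus is at most N + 2T. *)
Lemma value_coeff_bound :
  N.+1%:R * `|a j| <= B ^+ 2 * S + N.+1%:R * (`|b j| * (N%:R + 2 * T)).
Proof.
have KN' : (0 + s.-1.*2 * K <= N)%N.
  by apply: leq_trans KN; case: (s) j => [[]|s' _] //=; lia.
have := window_HH _ KN'; rewrite [S * _]mulrC => W.
apply: le_trans (lerD W (lexx _)); rewrite /window.
rewrite !mulr_natl -[N.+1 in X in X <= _]card_ord.
rewrite -[N.+1 in X in _ <= _ + X]card_ord -!sumr_const -big_split /=.
apply: ler_sum => n _.
rewrite hermite_double_root // prod_factor_val // expr1n !mulr1.
set d := _^`().[z j]; set d' := _^`().[z j].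
have dn : `|d| <= N%:R.
  rewrite /d derivXn hornerMn hornerXn normrMn normrX z1 expr1n.
  by rewrite add0n ler_nat -ltnS.
have d'T : `|d'| <= T.
  by apply: le_trans (prod_factor_deriv _ rj) _; rewrite /r big_filter.
have -> : `|a j| = `|a j * ('X^(0 + n)).[z j]|.
  by rewrite normrM hornerXn normrX z1 expr1n mulr1.
set A := a j * _; set E := d + _.
have -> : A = (A + b j * E) - b j * E by ring.
apply: le_trans (ler_normB _ _) _.
rewrite addrNK lerD2l normrM ler_wpM2l // /E; apply: le_trans (ler_normD _ _) _.
apply: lerD => //; rewrite hornerXn !normrM normrX z1 expr1n mul1r normr_nat.
by rewrite -[T *+ 2]mulr_natl ler_wpM2l.
Qed.

End HermiteFunctional.

(** * Chords of the unit circle *)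

Lemma expiX (R : realType) (t : R) n : expi t ^+ n = expi (n%:R * t).
Proof.
elim: n => [|n IH]; first by rewrite mul0r expr0 /expi cos0 sin0.
rewrite exprSr IH -[n.+1%:R]natr1 mulrDl mul1r /expi cosD sinD.
by rewrite /GRing.mul /=; congr (_ +i* _)%C; rewrite addrC.
Qed.

Lemma normc_expi (R : realType) (t : R) : normc (expi t) = 1.
Proof. by rewrite /expi /= cos2Dsin2 sqrtr1. Qed.

Lemma sqr_normc_expiB (R : realType) (t u : R) :
  normc (expi t - expi u) ^+ 2 = 2 - 2 * cos (t - u).
Proof.
rewrite /expi /= sqr_sqrtr ?addr_ge0 ?sqr_ge0 // cosB.
have := cos2Dsin2 t; have := cos2Dsin2 u.
move: (cos t) (cos u) (sin t) (sin u) => c c' d d' h h'.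
have -> : (c - c') ^+ 2 + (d - d') ^+ 2 =
  (c ^+ 2 + d ^+ 2) + (c' ^+ 2 + d' ^+ 2) - 2 * (c * c' + d * d') by ring.
by rewrite h h'.
Qed.

Lemma sin_ge_half (R : realType) (t : R) : 0 <= t <= pi / 4 -> t / 2 <= sin t.
Proof.
move=> /andP[t0 t1]; have p0 := pi_gt0 R.
have sin_cont : {within `[0, t], continuous (@sin R)}%classic.
  by apply: derivable_within_continuous => x _; apply: ex_derive.
have [c] := MVT_segment t0 (fun x _ => is_derive_sin x) sin_cont.
rewrite in_itv /= sin0 !subr0 => /andP[c0 ct] ->.
suff: 1 / 2 <= cos c by move=> h; nra.
(* From 0 <= cos 2c = 2 cos^2 c - 1 and cos c >= 0 follows cos c >= 1/2. *)
have h2 : 0 <= cos (c *+ 2) by apply: cos_ge0_pihalf; lra.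
have h1 : 0 <= cos c by apply: cos_ge0_pihalf; lra.
by move: h2; rewrite cos_mulr2n => h2; nra.
Qed.

(** With d = |t - u|, the chord dominates sin d, since 2 - 2 cos d - sin^2 d = (1 - cos d)^2. *)
Lemma normc_expiB_ge_half (R : realType) (t u : R) : `|t - u| <= pi / 4 ->
  `|t - u| / 2 <= normc (expi t - expi u).
Proof.
move=> tu; have : `|t - u| / 2 <= sin `|t - u| by apply: sin_ge_half; rewrite normr_ge0.
have n0 : 0 <= normc (expi t - expi u) by rewrite /= sqrtr_ge0.
have := sqr_normc_expiB _ t u; rewrite -(cos_norm (t - u)).
have := cos2Dsin2 `|t - u|; have := normr_ge0 (t - u).
move: (`|_|) (sin _) (cos _) n0 => d S c n0 d0 h1 h2 h3.
rewrite -(@ler_pXn2r _ 2) ?nnegrE //; nra.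
Qed.

Lemma normc_expiB_ge1 (R : realType) (t u : R) :
  pi / 2 <= `|t - u| <= pi + pi / 2 ->
  1 <= normc (expi t - expi u).
Proof.
move=> tu.
have n0 : 0 <= normc (expi t - expi u) by rewrite /= sqrtr_ge0.
have : 0 <= cos (`|t - u| - pi) by apply: cos_ge0_pihalf; lra.
rewrite cosB cospi sinpi mulr0 addr0 mulrN1 => c0.
have := sqr_normc_expiB _ t u; rewrite -(cos_norm (t - u)) => h.
by rewrite -(@ler_pXn2r _ 2) ?nnegrE // expr1n; nra.
Qed.

Lemma wdist_small (R : realType) (t : R) : - pi < t <= pi -> wdist t = `|t|.
Proof.
move=> tpi; have p0 := pi_gt0 R; rewrite /wdist /Arg_exp (@ceil_def _ _ 0) ?mulr0 ?subr0 //.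
by rewrite ltr_pdivlMr ?ler_pdivrMr ?mulr_gt0 // sub0r; lra.
Qed.

(** * [U_N] in terms of the Hermite functional, and comparison of norms *)

Lemma hermiteXn (C : numFieldType) s (z a b : 'I_s -> C) n :
  hermite C s z a b 'X^n = \sum_m (a m * z m ^+ n + b m * (n%:R * z m ^+ n.-1)).
Proof.
apply: eq_bigr => m _.
by rewrite derivXn hornerMn !hornerXn [n%:R * _]mulr_natl.
Qed.

Lemma U_N_mulE (R : realType) N s (xi : 'I_s -> R) (v : 'cV[R[i]]_(s + s)) k :
  (U_N N xi *m v) k 0 = (((Num.sqrt (2 * N)%:R)^-1)%:C%C *
    hermite R[i] s (fun m => expi (xi m)) (fun m => v (lshift s m) 0)
      (fun m => v (rshift s m) 0) 'X^k)%R.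
Proof.
rewrite hermiteXn mxE big_split_ord /= -big_split mulr_sumr /=.
apply: eq_bigr => m _; rewrite !mxE.
by rewrite (unsplitK (inl m)) (unsplitK (inr m)); ring.
Qed.

(** Cauchy-Schwarz against the constant vector 1. *)
Lemma sqr_sum_le (R : realDomainType) n (x : 'I_n -> R) :
  (\sum_i x i) ^+ 2 <= n%:R * \sum_i x i ^+ 2.
Proof.
elim: n x => [|n IH] x; first by rewrite !big_ord0 expr0n mulr0.
rewrite !big_ord_recr /=; set y := x ord_max.
have := IH (fun i => x (widen_ord (leqnSn n) i)) => /=.
have : 2 * y * (\sum_(i < n) x (widen_ord (leqnSn n) i)) <=
    n%:R * y ^+ 2 + \sum_(i < n) x (widen_ord (leqnSn n) i) ^+ 2.
  have -> : n%:R * y ^+ 2 = \sum_(i < n) y ^+ 2.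
    by rewrite sumr_const card_ord mulr_natl.
  rewrite mulr_sumr -big_split /=; apply: ler_sum => i _.
  by have := sqr_ge0 (y - x (widen_ord (leqnSn n) i)); nra.
rewrite -[n.+1%:R]natr1; move: (\sum_i _) (\sum_i _) => S Q h1 h2.
by nra.
Qed.

Lemma normc_ge0 (R : realType) (w : R[i]) : 0 <= normc w.
Proof. by rewrite -lecR; exact: (normr_ge0 w). Qed.

Lemma sum_normc_le (R : realType) n (w : 'cV[R[i]]_n) :
  \sum_i normc (w i 0) <= Num.sqrt n%:R * vnorm w.
Proof.
rewrite /vnorm -sqrtrM ?ler0n // -[leLHS]ger0_norm ?sumr_ge0 // => [|i _];
  last exact: normc_ge0.
by rewrite -sqrtr_sqr ler_wsqrtr // sqr_sum_le.
Qed.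

Lemma vnorm_le (R : realType) n (w : 'cV[R[i]]_n) M :
  (forall i, normc (w i 0) <= M) -> 0 <= M -> vnorm w <= n%:R * M.
Proof.
move=> wM M0; rewrite -[leRHS]ger0_norm ?mulr_ge0 // -sqrtr_sqr /vnorm ler_wsqrtr //.
apply: (@le_trans _ _ (\sum_(i < n) M ^+ 2)).
  by apply: ler_sum => i _; rewrite ler_pXn2r ?nnegrE ?normc_ge0.
rewrite sumr_const card_ord -[leLHS]mulr_natl exprMn ler_wpM2r ?sqr_ge0 //.
by rewrite -natrX ler_nat; nia.
Qed.

(** * Coefficient bounds at one node, with x standing for K Delta *)

Section CoefficientBounds.
Variables (R : realType) (s N : nat) (t : 'I_s -> R) (a b : 'I_s -> R[i]).
Variables (j : 'I_s) (k : 'I_s -> nat) (K : nat).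
Hypothesis kK : forall m, (k m <= K)%N.
Hypothesis KN : (s.*2.-1 * K <= N)%N.

Let z m := expi (t m).
Let d m := normc (expi ((k m)%:R * t j) - expi ((k m)%:R * t m)).
Let B := \prod_(m | m != j) (2 * (d m)^-1).
Let T := \sum_(m | m != j) K%:R * (d m)^-1.
Let S := \sum_(n < (2 * N).+1) normc (hermite R[i] s z a b 'X^n).

Hypothesis d_gt0 : forall m, m != j -> 0 < d m.

Let z1 m : `|z m| = 1.
Proof. by rewrite -[1](@rmorph1 _ _ (real_complex R)) -(normc_expi _ (t m)). Qed.

Let zjk m : m != j -> z j ^+ k m != z m ^+ k m.
Proof.
move=> /d_gt0; rewrite /d /z !expiX -subr_eq0.
by apply: contraTneq => ->; rewrite ComplexField.Normc.normc0 ltxx.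
Qed.

(** Norms in [R[i]] are themselves complex; such identities carry the estimates back along the
    embedding of [R]. *)
Let normE m : `|(z j ^+ k m - z m ^+ k m)^-1| = ((d m)^-1)%:C%C.
Proof. by rewrite /z !expiX normfV fmorphV. Qed.

Let BE : \prod_(m | m != j) (2 * `|(z j ^+ k m - z m ^+ k m)^-1|) = B%:C%C.
Proof.
rewrite rmorph_prod; apply: eq_bigr => m _.
by rewrite normE rmorphM rmorph_nat.
Qed.

Let TE : \sum_(m | m != j) K%:R * `|(z j ^+ k m - z m ^+ k m)^-1| = T%:C%C.
Proof.
rewrite rmorph_sum; apply: eq_bigr => m _.
by rewrite normE rmorphM rmorph_nat.
Qed.

Let SE : \sum_(n < (2 * N).+1) `|hermite R[i] s z a b 'X^n| = S%:C%C.
Proof. by rewrite rmorph_sum. Qed.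

Let derivative_bound : K%:R * N.+1%:R * normc (b j) <= 2 * B ^+ 2 * S.
Proof.
rewrite -lecR !rmorphM !rmorph_nat /= -BE -SE.
exact: derivative_coeff_bound z1 kK zjk KN.
Qed.

Let value_bound : N.+1%:R * normc (a j) <=
  B ^+ 2 * S + N.+1%:R * (normc (b j) * (N%:R + 2 * T)).
Proof.
rewrite -lecR !(rmorphM, rmorphD) !rmorph_nat /= -BE -SE -TE.
exact: value_coeff_bound z1 kK zjk KN.
Qed.

Variables (near : {set 'I_s}) (ell : nat) (x : R).
Hypothesis x01 : 0 < x <= 1.
Hypothesis jnear : j \in near.
Hypothesis near_ell : (#|near| <= ell)%N.
Hypothesis d_near : forall m, m != j -> m \in near -> x / 2 <= d m.
Hypothesis d_far : forall m, m \notin near -> 1 <= d m.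

Let x0 : 0 < x. Proof. by case/andP: x01. Qed.

Let y1 : 1 <= x^-1.
Proof. by rewrite invf_ge1 //; case/andP: x01. Qed.

Let y0 : 0 <= x^-1 := le_trans ler01 y1.

Let ell_gt0 : (0 < ell)%N.
Proof.
by apply: leq_trans near_ell; rewrite card_gt0; apply/set0Pn; exists j.
Qed.

Let d_inv m : m != j -> (d m)^-1 <= 2 * (if m \in near then x^-1 else 1).
Proof.
move=> mj; case: ifP => [/d_near|/negbT/d_far] dm.
  have {}dm := dm mj; rewrite -[2]invrK -invfM lef_pV2 ?posrE ?d_gt0 //.
    by rewrite mulrC dm.
  by rewrite mulr_gt0 ?invr_gt0.
by rewrite mulr1 -[2]invrK lef_pV2 ?posrE ?d_gt0 //; lra.
Qed.

(** Each factor costs at most 4, with a further 1/x for the at most ell - 1 nodes of [near] other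
    than j. *)
Let B_le : 0 <= B <= 4 ^+ s * x^-1 ^+ ell.-1.
Proof.
apply/andP; split.
  by apply: prodr_ge0 => m mj; rewrite mulr_ge0 // invr_ge0 ltW ?d_gt0.
apply: (@le_trans _ _ (\prod_(m | m != j) (4 * (if m \in near then x^-1 else 1)))).
  apply: ler_prod => m mj; have dm := d_inv _ mj.
  have d0 : 0 <= (d m)^-1 by rewrite invr_ge0 ltW ?d_gt0.
  rewrite mulr_ge0 //=; have -> : 4 = 2 * 2 :> R by ring.
  by rewrite -mulrA ler_pM2l.
rewrite big_split /= -big_mkcondr /= !prodr_const.
apply: ler_pM; rewrite ?exprn_ge0 //.
  by apply: ler_weXn2l; rewrite ?ler1n // -[leqRHS]card_ord max_card.
apply: ler_weXn2l => //.
rewrite -ltnS prednK //; apply: leq_trans near_ell.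
rewrite (cardsD1 j near) jnear add1n ltnS; apply: subset_leq_card.
by apply/fintype.subsetP => m; rewrite !inE.
Qed.

(** The worst case 2/x for every node suffices: T enters linearly and adds only one power of 1/x. *)
Let T_le : 0 <= T <= 2 * s%:R * K%:R * x^-1.
Proof.
apply/andP; split.
  by apply: sumr_ge0 => m mj; rewrite mulr_ge0 // invr_ge0 ltW ?d_gt0.
apply: (@le_trans _ _ (\sum_(m | m != j) K%:R * (2 * x^-1))).
  apply: ler_sum => m mj; rewrite ler_wpM2l //.
  by apply: le_trans (d_inv _ mj) _; case: ifP => _; have := y1; lra.
rewrite sumr_const -[leLHS]mulr_natl.
have -> : 2 * s%:R * K%:R / x = s%:R * (K%:R * (2 * x^-1)) by ring.
rewrite ler_wpM2r ?mulr_ge0 //.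
by rewrite ler_nat -[leqRHS]card_ord max_card.
Qed.

Hypothesis K_gt0 : (0 < K)%N.
Hypothesis NK : (N <= 8 * s * K)%N.

(** 16^s and x^-(2 ell - 2) come from B^2, one more 1/x from T; 25 = 1 + 2 * 12 adds the window term
    and the b_j term. *)
Let M := 25 * s%:R * 16 ^+ s * x^-1 ^+ (2 * ell - 1) * S.

Lemma coeff_bounds :
  N.+1%:R * normc (a j) <= M /\ N.+1%:R * normc (b j) <= M.
Proof.
have s1 : 1 <= s%:R :> R by rewrite ler1n; case: (s) j => [[]|].
have y0' := y0; have y1' := y1.
have K1 : 1 <= K%:R :> R by rewrite ler1n.
have S0 : 0 <= S by apply: sumr_ge0 => n _; exact: normc_ge0.
set P := 16 ^+ s * x^-1 ^+ (2 * ell.-1).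
have BP : B ^+ 2 <= P.
  have /andP[B0 Ble] := B_le; apply: (@le_trans _ _ ((4 ^+ s * x^-1 ^+ ell.-1) ^+ 2)).
    by rewrite ler_pXn2r ?nnegrE // (le_trans B0).
  rewrite exprMn -!exprM [(ell.-1 * 2)%N]mulnC [(s * 2)%N]mulnC exprM.
  by rewrite le_eqVlt /P -[4 ^+ 2]natrX eqxx.
have P0 : 0 <= P by apply: le_trans BP; rewrite sqr_ge0.
have ME : M = 25 * s%:R * x^-1 * (P * S).
  have e : (2 * ell - 1 = (2 * ell.-1).+1)%N by move: ell_gt0; clear; lia.
  rewrite /M /P e exprS; move: (16 ^+ s) (x^-1 ^+ _) => p q.
  by rewrite !mulrA; congr (_ * _); ring.
rewrite ME.
have PS0 : 0 <= P * S by rewrite mulr_ge0.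
have BS : B ^+ 2 * S <= P * S by rewrite ler_wpM2r.
have /andP[T0 Tle] := T_le.
have NK' : N%:R <= 8 * s%:R * K%:R :> R by rewrite -!natrM ler_nat.
have sy : 1 <= s%:R * x^-1 by rewrite -[leLHS]mulr1 ler_pM.
have sle : s%:R <= s%:R * x^-1 by rewrite ler_peMr //; lra.
set c := N.+1%:R * normc (b j).
have c0 : 0 <= c by rewrite mulr_ge0 // normc_ge0.
have Kc : K%:R * c <= 2 * (P * S).
  by rewrite /c mulrA; apply: le_trans derivative_bound _; lra.
split; last first.
  apply: (@le_trans _ _ (2 * (P * S))); last by rewrite ler_wpM2r //; lra.
  by apply: le_trans Kc; rewrite ler_peMl.
apply: le_trans value_bound _.
have -> : N.+1%:R * (normc (b j) * (N%:R + 2 * T)) = c * (N%:R + 2 * T).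
  by rewrite /c; ring.
(* N <= 8sK and 2T <= 4sK/x; the factor K is then absorbed by [Kc]. *)
have h : c * (N%:R + 2 * T) <= c * (K%:R * (12 * (s%:R * x^-1))).
  rewrite ler_wpM2l //.
  have : 8 * s%:R * K%:R <= 8 * (s%:R * x^-1) * K%:R by rewrite ler_wpM2r //; lra.
  by lra.
have h' : c * (K%:R * (12 * (s%:R * x^-1))) <= 2 * (P * S) * (12 * (s%:R * x^-1)).
  rewrite [leLHS](_ : _ = K%:R * c * (12 * (s%:R * x^-1))); last by ring.
  by apply: ler_wpM2r => //; lra.
have h'' : P * S <= s%:R * x^-1 * (P * S) by rewrite ler_peMl.
by lra.
Qed.

End CoefficientBounds.

(** * Lower bounds for [sigma_min] and choice of the exponents *)

Lemma sigma_min_ge (R : realType) m n (A : 'M[R[i]]_(m, n)) c : (0 < n)%N ->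
  (forall v, vnorm v = 1 -> c <= vnorm (A *m v)) -> c <= sigma_min A.
Proof.
move=> n0 h; apply: lb_le_inf; last by move=> _ [v /= v1 <-]; exact: h.
(* The infimum of an empty set is a default value, so a unit vector must be exhibited. *)
pose i0 := Ordinal n0; pose v : 'cV[R[i]]_n := delta_mx i0 0.
exists (vnorm (A *m v)), v => //=.
rewrite /vnorm (bigD1 i0) //= big1 => [|i ii0]; rewrite !mxE ?eqxx /=.
  by rewrite !(expr1n, expr0n, addr0, sqrtr1).
by rewrite (negbTE ii0) /= !(expr0n, addr0, sqrtr0).
Qed.

Lemma block_length (s N : nat) : (0 < s)%N -> (16 * s <= N)%N ->
  exists K, [/\ (0 < K)%N, (N <= 8 * s * K)%N, (K * (4 * s) <= N)%N,
    (s.*2.-1 * K <= N)%N & forall k, (k * (4 * s) <= N)%N -> (k <= K)%N].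
Proof.
move=> s0 sN; have s4 : (0 < 4 * s)%N by rewrite muln_gt0.
(* The largest K with 4sK <= N; since K >= 1, N < 4s(K + 1) <= 8sK. *)
exists (N %/ (4 * s))%N.
have Kmax k : (k * (4 * s) <= N)%N -> (k <= N %/ (4 * s))%N by rewrite leq_divRL.
have K0 : (0 < N %/ (4 * s))%N by apply: Kmax; clear - sN; lia.
have K4 : (N %/ (4 * s) * (4 * s) <= N)%N := leq_divM _ _.
have := ltn_ceil N s4; move: Kmax K0 K4; move: (N %/ _)%N => K Kmax K0 K4 NK.
split=> //.
  by apply: leq_trans (ltnW NK) _; clear - K0; nia.
by apply: leq_trans K4; clear; nia.
Qed.

(** The K-th powers stay within an eighth of a turn, where the chord is at least half the arc. *)
Lemma near_exponent (R : realType) (t u : R) (K : nat) Delta tau :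
  K%:R * (tau * Delta) <= pi / 4 -> Delta <= `|t - u| <= tau * Delta ->
  K%:R * Delta / 2 <= normc (expi (K%:R * u) - expi (K%:R * t)).
Proof.
move=> Ktau /andP[h1 h2]; have K0 : 0 <= K%:R :> R by [].
have e : `|K%:R * u - K%:R * t| = K%:R * `|t - u|.
  by rewrite -mulrBr normrM ger0_norm // distrC.
have le_pi4 : `|K%:R * u - K%:R * t| <= pi / 4.
  by rewrite e; apply: le_trans Ktau; exact: ler_wpM2l.
apply: le_trans (normc_expiB_ge_half _ _ _ le_pi4); rewrite e.
by rewrite ler_pM2r ?invr_gt0 //; exact: ler_wpM2l.
Qed.

Lemma far_exponent (R : realType) (t u : R) (s N : nat) : (0 < s)%N ->
  (8 * s <= N)%N -> 4 * pi * s%:R <= N%:R * `|t - u| -> `|t - u| <= pi ->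
  exists2 k, (k * (4 * s) <= N)%N &
    1 <= normc (expi (k%:R * u) - expi (k%:R * t)).
Proof.
move=> s0 sN hN hpi; have p0 := pi_gt0 R.
have s0' : 0 < s%:R :> R by rewrite ltr0n.
set w := `|t - u| in hN hpi *.
have w0 : 0 < w.
  have : 0 < N%:R * w by apply: lt_le_trans hN; rewrite !mulr_gt0.
  by rewrite pmulr_rgt0 // ltr0n; lia.
set q := pi / 2 / w; have q0 : 0 <= q by rewrite !divr_ge0 // ltW.
have /andP[k1 k2] := truncn_itv q0.
(* The first multiple of w beyond pi/2 exceeds it by at most w <= pi. *)
exists (Num.trunc q).+1.
  (* Averaging this with 8s <= N pays for the successor. *)
  suff : ((Num.trunc q) * (8 * s) <= N)%N by lia.
  rewrite -(ler_nat R) natrM; apply: (@le_trans _ _ (q * (8 * s)%:R)).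
    by rewrite ler_wpM2r.
  rewrite /q natrM mulrAC ler_pdivrMr //; lra.
apply: normc_expiB_ge1; rewrite -mulrBr normrM ger0_norm // distrC -/w.
have qw : q * w = pi / 2 by rewrite /q divfK // gt_eqF.
apply/andP; split; first by rewrite -qw ler_wpM2r // ltW.
rewrite -natr1 mulrDl mul1r addrC; apply: lerD => //.
by rewrite -qw ler_wpM2r // ltW.
Qed.

(** * Assembly of the lower bound *)

Theorem theorem3p1 (R : realType) (s : nat) :
  exists C1 : R, 0 < C1 /\
  forall (Delta rho : R) (ell : nat) (tau : R) (xi : 'I_s -> R) (N : nat),
    0 < Delta -> 0 <= rho -> (2 <= ell <= s)%N ->
    (ell.-1)%:R <= tau <= pi / Delta ->
    4 * tau * Delta <= Num.min rho (s ^ 2)%:R^-1 ->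
    (forall j, - (pi / 2) / (s ^ 2)%:R < xi j <= (pi / 2) / (s ^ 2)%:R) ->
    clustered Delta rho s ell tau xi ->
    Num.max (4 * pi * s%:R / rho) (4 * (s ^ 3)%:R) <= N%:R <= pi * s%:R / (tau * Delta) ->
    sigma_min (U_N N xi) >= C1 * (N%:R * Delta) ^+ (2 * ell - 1).
Proof.
(* For s < 2 no ell satisfies 2 <= ell <= s. *)
have [s2|s2] := leqP 2 s; last first.
  by exists 1; split=> // Delta rho ell tau xi N _ _ /andP[h1 h2]; lia.
have s2R : 2 <= s%:R :> R by rewrite ler_nat.
(* 100 s^2 16^s is the dimension 2s times the 50 s 16^s of [M] below; (8s)^(2s) pays for replacing N
   Delta by K Delta, as 2 ell - 1 <= 2s. *)
exists ((100 * s%:R ^+ 2 * 16 ^+ s * (8 * s%:R) ^+ (2 * s))^-1); split.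
  by rewrite invr_gt0 !mulr_gt0 ?exprn_gt0 //; lra.
move=> Delta rho ell tau xi N D0 _ /andP[ell2 ells] /andP[tau1 _].
rewrite le_min => /andP[tau_rho _] xi_small [_ [_ _ clus]].
rewrite ge_max => /andP[/andP[rhoN s3N] Ntau].
have p0 := pi_gt0 R; have p4 := pihalf_lt2 R.
have tau1' : 1 <= tau by apply: le_trans tau1; rewrite ler1n; lia.
have tD : 0 < tau * Delta by rewrite mulr_gt0 //; lra.
have rho0 : 0 < rho by lra.
have s3N' : (4 * s ^ 3 <= N)%N by rewrite -(ler_nat R) natrM.
have s16N : (16 * s <= N)%N.
  by apply: leq_trans s3N'; rewrite !expnS; clear - s2; nia.
clear s3N'; have s_gt0 : (0 < s)%N := ltnW s2.
have [K [K0 NK K4 KN Kmax]] := block_length _ _ s_gt0 s16N.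
(* The upper bound on N enters here: K-th powers of a cluster do not wrap around. *)
have KtD : K%:R * (tau * Delta) <= pi / 4.
  have : N%:R * (tau * Delta) <= pi * s%:R by rewrite -ler_pdivlMr.
  have : K%:R * (4 * s%:R) <= N%:R :> R by rewrite -!natrM ler_nat.
  move=> h1 h2.
  have h3 : K%:R * (4 * s%:R) * (tau * Delta) <= pi * s%:R.
    by apply: le_trans h2; rewrite ler_wpM2r // ltW.
  have : s%:R * (K%:R * (tau * Delta)) <= s%:R * (pi / 4) by lra.
  by rewrite ler_pM2l //; lra.
set x := K%:R * Delta.
have x01 : 0 < x <= 1.
  rewrite mulr_gt0 ?ltr0n //=; apply: (@le_trans _ _ (K%:R * (tau * Delta))).
    by rewrite ler_wpM2l // ler_peMl // ltW.
  by lra.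
have x0 : 0 < x by case/andP: x01.
have xi_dist m j : wdist (xi m - xi j) = `|xi m - xi j| /\ `|xi m - xi j| <= pi.
  have hs : 1 <= (s ^ 2)%:R :> R by rewrite ler1n expn_gt0 s_gt0.
  have bnd i : - (pi / 2) < xi i <= pi / 2.
    have /andP[h1 h2] := xi_small i.
    have : pi / 2 / (s ^ 2)%:R <= pi / 2 :> R.
      by rewrite ler_pdivrMr ?ler_peMr //; lra.
    by move: h1; rewrite mulNr; lra.
  have := bnd m; have := bnd j => h1 h2.
  by split; [apply: wdist_small|rewrite ler_norml]; lra.
apply: sigma_min_ge => [|v v1]; first by rewrite addn_gt0 s_gt0.
set W := U_N N xi *m v.
pose a m := v (lshift s m) 0; pose b m := v (rshift s m) 0.
pose M := 50 * s%:R * 16 ^+ s * x^-1 ^+ (2 * ell - 1) * vnorm W.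
have M0 : 0 <= M.
  by rewrite !mulr_ge0 ?exprn_ge0 ?invr_ge0 ?sqrtr_ge0 // ltW.
(* sqrt(2N) undoes the scaling of [U_N] and sqrt(2N + 1) comes from Cauchy-Schwarz; the resulting N
   + 1 cancels the window length in [coeff_bounds]. *)
have SW : \sum_(n < (2 * N).+1) normc (hermite R[i] s (fun m => expi (xi m)) a b 'X^n)
    <= N.+1%:R * (2 * vnorm W).
  set r := Num.sqrt (2 * N)%:R : R.
  have r0 : 0 < r by rewrite sqrtr_gt0 ltr0n; clear - s16N s_gt0; lia.
  have rr : r * Num.sqrt (2 * N).+1%:R <= N.+1%:R * 2.
    have -> : N.+1%:R * 2 = Num.sqrt ((N.+1 * 2) ^ 2)%:R :> R.
      by rewrite natrX sqrtr_sqr ger0_norm // natrM.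
    by rewrite /r -sqrtrM // -natrM ler_wsqrtr // ler_nat; clear; nia.
  apply: (@le_trans _ _ (r * \sum_i normc (W i 0))).
    rewrite mulr_sumr; apply: ler_sum => n _; rewrite U_N_mulE -/r -/a -/b.
    rewrite ComplexField.Normc.normcM.
    have -> : normc (r^-1)%:C%C = r^-1.
      by rewrite /= expr0n addr0 sqrtr_sqr ger0_norm // invr_ge0 ltW.
    by rewrite mulrA divff ?mul1r // gt_eqF.
  apply: (@le_trans _ _ (r * (Num.sqrt (2 * N).+1%:R * vnorm W))).
    by rewrite ler_wpM2l ?sum_normc_le // ltW.
  by rewrite !mulrA ler_wpM2r // sqrtr_ge0.
have vM i : normc (v i 0) <= M.
  suff ab j : normc (a j) <= M /\ normc (b j) <= M.
    by rewrite -(splitK i); case: (fintype.split i) => j /=; have [] := ab j.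
  have [near [jnear /andP[_ near_ell] dnear dfar]] := clus j.
  (* Take k = K inside the cluster, and outside it an exponent separating the two powers by at least
     a right angle. *)
  have /choice [k hk] : forall m, exists k : nat,
      [/\ (k <= K)%N,
          m != j -> m \in near ->
            x / 2 <= normc (expi (k%:R * xi j) - expi (k%:R * xi m)) &
          m \notin near ->
            1 <= normc (expi (k%:R * xi j) - expi (k%:R * xi m))].
    move=> m; have [wd dpi] := xi_dist m j.
    have [mnear|mfar] := boolP (m \in near).
      exists K; split=> // mj _; have := dnear _ mnear mj; rewrite wd.
      exact: near_exponent.
    have hN : 4 * pi * s%:R <= N%:R * `|xi m - xi j|.
      apply: (@le_trans _ _ (N%:R * rho)); first by rewrite -ler_pdivrMr.
      by rewrite ler_wpM2l // -wd dfar.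
    have [|k kK k1] := far_exponent _ _ _ _ _ s_gt0 _ hN dpi; first by clear - s16N; lia.
    by exists k; split=> //; exact: Kmax.
  have d0 m : m != j -> 0 < normc (expi ((k m)%:R * xi j) - expi ((k m)%:R * xi m)).
    have [_ hn hf] := hk m => mj; have [mnear|mfar] := boolP (m \in near).
      by apply: lt_le_trans (hn mj mnear); lra.
    exact: lt_le_trans (hf mfar).
  have kK m : (k m <= K)%N by case: (hk m).
  have hn m : m != j -> m \in near ->
      x / 2 <= normc (expi ((k m)%:R * xi j) - expi ((k m)%:R * xi m)).
    by case: (hk m).
  have hf m : m \notin near ->
      1 <= normc (expi ((k m)%:R * xi j) - expi ((k m)%:R * xi m)).
    by case: (hk m).
  have := coeff_bounds _ _ _ xi a b _ _ _ kK KN d0 _ _ _ x01 jnear near_ell hn hf K0 NK.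
  set M' := (X in _ <= X /\ _ <= X).
  have M'M : M' <= N.+1%:R * M.
    rewrite /M' /M; set Q := (X in X * _ <= _).
    have Q0 : 0 <= Q by rewrite !mulr_ge0 ?exprn_ge0 ?invr_ge0 // ltW.
    apply: le_trans (ler_wpM2l Q0 SW) _; rewrite le_eqVlt; apply/orP; left.
    apply/eqP; rewrite /Q; move: (16 ^+ s) (x^-1 ^+ _) (vnorm W) => p q w.
    by ring.
  move=> [ha hb]; split.
    by have := le_trans ha M'M; rewrite ler_pM2l.
  by have := le_trans hb M'M; rewrite ler_pM2l.
(* All entries of the unit vector v are at most M, so 1 <= 2sM, which bounds [vnorm W] from
   below. *)
have := vnorm_le _ _ _ _ vM M0; rewrite v1 /M.
set p := (2 * ell - 1)%N.
have xN : N%:R * Delta <= 8 * s%:R * x.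
  rewrite /x mulrA; apply: ler_wpM2r; first exact: ltW.
  by rewrite -!natrM ler_nat.
have xNp : (N%:R * Delta) ^+ p <= (8 * s%:R) ^+ (2 * s) * x ^+ p.
  apply: (@le_trans _ _ ((8 * s%:R * x) ^+ p)).
    have ND0 : 0 <= N%:R * Delta by rewrite mulr_ge0 // ltW.
    by apply: lerXn2r => //; rewrite nnegrE // (le_trans ND0).
  rewrite exprMn; apply: ler_wpM2r; first by rewrite exprn_ge0 // ltW.
  apply: ler_weXn2l; last by rewrite /p; clear - ells; lia.
  by have := s2R; clear; lra.
rewrite exprVn => h.
have s16 : 0 < 16 ^+ s :> R by rewrite exprn_gt0.
have xp : 0 < x ^+ p by rewrite exprn_gt0.
have s8 : 0 < (8 * s%:R) ^+ (2 * s) :> R by rewrite exprn_gt0 //; lra.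
have hx : x ^+ p <= 100 * s%:R ^+ 2 * 16 ^+ s * vnorm W.
  move: h; set u := vnorm W; rewrite -(ler_pM2r xp) mul1r => /le_trans; apply.
  rewrite natrD le_eqVlt; apply/orP; left; apply/eqP.
  move: xp; move: (x ^+ p) (16 ^+ s) => y c y0.
  by field; rewrite gt_eqF.
rewrite mulrC ler_pdivrMr; last by rewrite !mulr_gt0 ?exprn_gt0 //; lra.
apply: le_trans xNp _; rewrite mulrC; apply: le_trans (ler_wpM2r (ltW s8) hx) _.
move: (_ ^+ (2 * s)) (16 ^+ s) (vnorm W) => y c u.
by rewrite le_eqVlt; apply/orP; left; apply/eqP; ring.
Qed.
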